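(* For every network $\mathcal N$ and every integer $T\ge1$, $\mathcal R^{\mathcal N}\subseteq\mathcal R^{(\mathcal M_T,\mathcal E_T)}$.
   Context: A network is a triple $\mathcal N=(\mathcal L,\mathcal I,D_{\mathcal L})$ where $\mathcal L$ is a finite nonempty set of links, each $\mathcal I(l)$ is a collection of nonempty subsets of $\mathcal L$, and $D_{\mathcal L}$ assigns an integer $D_{\mathcal L}(l,l')$ to every pair with $l'\in\phi$ for some $\phi\in\mathcal I(l)$. A schedule is a map $S:\mathcal L\times\mathbb Z\to\{0,1\}$; $S(l,t)$ has a collision if there is $\phi\in\mathcal I(l)$ with $S(l',t+D_{\mathcal L}(l,l'))=1$ for all $l'\in\phi$; $S$ is collision free if no $(l,t)$ with $S(l,t)=1$ has a collision. $R_S(l)=\lim_{T\to\infty}\frac1T\sum_{t=0}^{T-1}\iota\big(S(l,t)=1\text{ and collision free}\big)$ when it exists; $R_S=(R_S(l))_l$ is the rate vector. A nonnegative vector $R\in[0,\infty)^{\mathcal L}$ is achievable if for every $\epsilon>0$ some schedule $S$ has a rate vector with $R_S(l)\ge R(l)-\epsilon$ for all $l$; $\mathcal R^{\mathcal N}$ is the set of achievable nonnegative vectors. $S[T,k]$ is the $|\mathcal L|\times T$ binary matrix with $S[T,k](l,j)=S(l,kT+j)$. The scheduling graph $(\mathcal M_T,\mathcal E_T)$ has vertex set $\mathcal M_T$ = all $|\mathcal L|\times T$ binary matrices $A$ with $A=S[T,0]$ for some collision-free schedule $S$, and edge set $\mathcal E_T$ = all pairs $(A,B)$ with $A=S[T,0]$,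 $B=S[T,1]$ for some collision-free schedule $S$. A cycle is a sequence $(A_0,\dots,A_k)$, $k\ge1$, with $(A_i,A_{i+1})\in\mathcal E_T$ for all $i$, $A_k=A_0$, and $A_0,\dots,A_{k-1}$ pairwise distinct; its rate vector is $R_C=\frac{1}{kT}\sum_{i=0}^{k-1}A_i\mathbf 1$ ($\mathbf 1$ the all-ones vector of length $T$). $\mathcal R^{(\mathcal M_T,\mathcal E_T)}$ is the convex hull of the rate vectors of all cycles of $(\mathcal M_T,\mathcal E_T)$. *)

(* Defs.v *)
From HB Require Import structures.
From mathcomp Require Import all_boot all_order all_algebra.
From mathcomp Require Import all_classical all_reals all_analysis.
Set Implicit Arguments. Unset Strict Implicit. Unset Printing Implicit Defensive.
Import Order.TTheory GRing.Theory Num.Theory.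
Import numFieldNormedType.Exports.
Local Open Scope ring_scope.

Section Network.
Variables (L : finType) (I : L -> {set {set L}}) (D : L -> L -> int).

Definition schedule := L -> int -> bool.

Definition collision (S : schedule) (l : L) (t : int) : bool :=
  [exists phi in I l, [forall l' in phi, S l' (t + D l l')]].

Definition collision_free (S : schedule) : Prop :=
  forall l t, S l t -> ~~ collision S l t.

Definition avg_success (R : realType) (S : schedule) (l : L) (T : nat) : R :=
  (T%:R)^-1 * (\sum_(t < T) ((S l (nat_of_ord t)%:Z && ~~ collision S l (nat_of_ord t)%:Z) : nat)%:R).

Definition is_rate_vector (R : realType) (S : schedule) (r : L -> R) : Prop :=
  forall l, (avg_success R S l @ \oo --> r l)%classic.

Definition achievable (R : realType) (r : L -> R) : Prop :=
  (forall l, 0 <= r l) /\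
  forall eps : R, 0 < eps ->
    exists (S : schedule) (rS : L -> R),
      is_rate_vector S rS /\ forall l, r l - eps <= rS l.

Definition bmat (T : nat) := {ffun L * 'I_T -> bool}.

Definition block (S : schedule) (T : nat) (k : int) : bmat T :=
  [ffun p : L * 'I_T => S p.1 (k * T%:Z + (nat_of_ord p.2)%:Z)].

Definition sg_vertex (T : nat) (A : bmat T) : Prop :=
  exists S, collision_free S /\ A = block S T 0.

Definition sg_edge (T : nat) (A B : bmat T) : Prop :=
  exists S, collision_free S /\ A = block S T 0 /\ B = block S T 1.

Definition is_cycle (T : nat) (k : nat) (A : nat -> bmat T) : Prop :=
  (0 < k)%N /\
  (forall i, (i < k)%N -> sg_edge (A i) (A i.+1)) /\
  A k = A 0%N /\
  (forall i j, (i < k)%N -> (j < k)%N -> A i = A j -> i = j).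

Definition cycle_rate (R : realType) (T k : nat) (A : nat -> bmat T) : L -> R :=
  fun l => ((k * T)%N%:R)^-1 *
           \sum_(i < k) \sum_(j < T) (A (nat_of_ord i) (l, j) : nat)%:R.

Definition cycle_rates (R : realType) (T : nat) : set (L -> R) :=
  [set r | exists k (A : nat -> bmat T), is_cycle k A /\ r = cycle_rate R k A].

End Network.

Definition conv_hull (L : finType) (R : realType) (P : set (L -> R)) : set (L -> R) :=
  [set x | exists (n : nat) (w : 'I_n -> R) (p : 'I_n -> L -> R),
     (forall i, 0 <= w i) /\ \sum_(i < n) w i = 1 /\ (forall i, P (p i)) /\
     forall l, x l = \sum_(i < n) w i * p i l].

(* Main.v *)
Require Import Defs.
From HB Require Import structures.
From mathcomp Require Import all_boot all_order all_algebra.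
From mathcomp Require Import all_classical all_reals all_analysis.
From mathcomp Require Import zify ring lra.
Set Implicit Arguments. Unset Strict Implicit. Unset Printing Implicit Defensive.
Import Order.TTheory GRing.Theory Num.Theory.
Local Open Scope ring_scope.

(** Discarding the collided transmissions of a schedule leaves a collision-free
    one, whose successive blocks form a walk in the scheduling graph.  Cutting out
    the cycles of a walk of length n leaves a simple walk, of length less than the
    number of vertices, so the averages along the walk are within O(1/n) of the
    convex hull of the cycle rates.  There are finitely many cycle rates, so by
    compactness some point x of the hull satisfies r <= x.  Finally the hull is
    closed under decreasing coordinates (down to 0): silencing one link in every block turns a
    cycle into a closed walk, which decomposes into cycles again, and any value in
    between is reached by convexity. *)

(** * Nonnegative combinations of given total weight *)

Section Cone.
Context {R : realType} {L : finType}.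
Implicit Types (P : set (L -> R)) (m : R) (v x : L -> R).

(* [cone P m v]: v is a nonnegative combination of points of P of total weight m;
   the weight is kept general so that cycles can be added up along a walk. *)
Inductive cone P : R -> (L -> R) -> Prop :=
| cone0 : cone P 0 (fun=> 0)
| cone_cons w p m v : 0 <= w -> P p -> cone P m v ->
    cone P (w + m) (fun l => w * p l + v l).

Lemma cone_eq P m m' v v' : cone P m v -> m = m' -> v =1 v' -> cone P m' v'.
Proof. by move=> h <- /funext <-. Qed.

Lemma coneD P m m' v v' :
  cone P m v -> cone P m' v' -> cone P (m + m') (fun l => v l + v' l).
Proof.
move=> h h'; elim: h => [|w p n u w0 Pp _ IH].
  by apply: cone_eq h' _ _ => [|l]; rewrite add0r.
by apply: cone_eq (cone_cons w0 Pp IH) _ _ => [|l]; rewrite addrA.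
Qed.

Lemma coneZ P a m v : 0 <= a -> cone P m v -> cone P (a * m) (fun l => a * v l).
Proof.
move=> a0; elim=> [|w p n u w0 Pp _ IH].
  by apply: cone_eq (cone0 P) _ _ => [|l]; rewrite mulr0.
apply: cone_eq (cone_cons (mulr_ge0 a0 w0) Pp IH) _ _ => [|l]; rewrite mulrDr //.
by rewrite mulrA.
Qed.

Lemma cone_gen P p : P p -> cone P 1 p.
Proof.
move=> Pp; apply: cone_eq (cone_cons ler01 Pp (cone0 P)) _ _ => [|l];
by rewrite ?mul1r addr0.
Qed.

Lemma cone_bind P P' (g : (L -> R) -> L -> R) m v :
    (forall p, P p -> cone P' 1 (g p)) -> g (fun=> 0) =1 (fun=> 0) ->
    (forall w p u, g (fun l => w * p l + u l) =1 fun l => w * g p l + g u l) ->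
  cone P m v -> cone P' m (g v).
Proof.
move=> PP' g0 gD; elim=> [|w p n u w0 /PP' Pp _ IH].
  by apply: cone_eq (cone0 P') _ _ => // l; rewrite g0.
by apply: cone_eq (coneD (coneZ w0 Pp) IH) _ _ => [|l]; rewrite ?mulr1 // gD.
Qed.

Lemma cone_ge0 P m v :
  (forall p, P p -> forall l, 0 <= p l) -> cone P m v -> forall l, 0 <= v l.
Proof.
move=> P0; elim=> // w p n u w0 /P0 p0 _ IH l.
by rewrite addr_ge0 // mulr_ge0.
Qed.

(** Merging the weights of repeated generators bounds the number of terms by [N], so weights become
    points of a space of fixed dimension, where compactness applies. *)
Lemma cone_family N (q : 'I_N -> L -> R) P m v :
    (forall p, P p -> exists i, p = q i) -> cone P m v ->
  exists w : 'I_N -> R, [/\ forall i, 0 <= w i, \sum_i w i = m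
    & forall l, v l = \sum_i w i * q i l].
Proof.
move=> Pq; elim=> [|a p n u a0 /Pq[i ->] _ [w [w0 ws wu]]].
  by exists (fun=> 0); split=> // [|l]; rewrite big1 // => i _; rewrite mul0r.
exists (fun j => (if j == i then a else 0) + w j); split=> [j|| l].
- by rewrite addr_ge0 //; case: ifP.
- by rewrite big_split /= -big_mkcond big_pred1_eq ws.
under eq_bigr do rewrite mulrDl.
rewrite big_split /= -wu (bigD1 i) //= eqxx big1 ?addr0 // => j /negbTE ->.
by rewrite mul0r.
Qed.

Lemma cone_sum N (w : 'I_N -> R) (p : 'I_N -> L -> R) P :
    (forall i, 0 <= w i) -> (forall i, P (p i)) ->
  cone P (\sum_i w i) (fun l => \sum_i w i * p i l).
Proof.
elim: N w p => [|N IH] w p w0 Pp.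
  by apply: cone_eq (cone0 P) _ _ => [|l]; rewrite big_ord0.
apply: cone_eq (cone_cons (w0 ord0) (Pp ord0)
  (IH (fun i => w (lift ord0 i)) (fun i => p (lift ord0 i)) _ _)) _ _ => // [|l];
by rewrite big_ord_recl.
Qed.

Lemma conv_hullE P x : conv_hull P x <-> cone P 1 x.
Proof.
split=> [[N [w [p [w0 [ws [Pp xE]]]]]]|].
  by apply: cone_eq (cone_sum w0 Pp) ws _ => l; rewrite xE.
(* Unfolding the hull exposes its total 1, which the induction generalises to an arbitrary
   weight. *)
have : cone P 1 x -> exists (N : nat) (w : 'I_N -> R) (p : 'I_N -> L -> R),
    (forall i, 0 <= w i) /\ \sum_i w i = 1 /\ (forall i, P (p i)) /\
    forall l, x l = \sum_i w i * p i l; last exact.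
elim=> [|w p m v w0 Pp _ [N [W [Q [W0 [Ws [PQ vE]]]]]]].
  exists 0%N, (fun=> 0), (fun=> fun=> 0); split=> //.
  by split; [rewrite big_ord0|split=> [[]//|l]; rewrite big_ord0].
exists N.+1, (fun i => oapp W w (unlift ord0 i)),
  (fun i => oapp Q p (unlift ord0 i)).
split=> [i|]; first by case: (unlift ord0 i) => [j|] /=; [exact: W0|].
split.
  by rewrite big_ord_recl unlift_none; under eq_bigr do rewrite liftK; rewrite /= Ws.
split=> [i|l]; first by case: (unlift ord0 i) => [j|] /=; [exact: PQ|].
by rewrite big_ord_recl unlift_none vE; under [in RHS]eq_bigr do rewrite liftK.
Qed.

(** Coordinates are lowered one at a time: mixing [v] with its masked version in proportion
    [a / v l0] gives [a] at [l0] and changes no other coordinate. *)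
Lemma cone_down P :
    (forall p, P p -> forall l, 0 <= p l) ->
    (forall p l0, P p -> cone P 1 (fun l => if l == l0 then 0 else p l)) ->
  forall x y, cone P 1 x -> (forall l, 0 <= y l <= x l) -> cone P 1 y.
Proof.
move=> P0 Pmask x y Px yx.
have mask v l0 : cone P 1 v -> cone P 1 (fun l => if l == l0 then 0 else v l).
  apply: (@cone_bind P P (fun v l => if l == l0 then 0 else v l)) => [p| l|w p u l].
  - exact: Pmask.
  - by case: ifP.
  - by case: ifP => // _; rewrite mulr0 addr0.
have lower v l0 a : cone P 1 v -> 0 <= a <= v l0 ->
    cone P 1 (fun l => if l == l0 then a else v l).
  move=> Pv /andP[a0 av].
  have [v0|v0] := eqVneq (v l0) 0.
    apply: cone_eq Pv _ _ => // l; case: eqP => // ->; lra.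
  have {}v0 : 0 < v l0 by rewrite lt_neqAle eq_sym v0 (le_trans a0).
  have t0 : 0 <= a / v l0 by rewrite divr_ge0 // ltW.
  have t1 : 0 <= 1 - a / v l0 by rewrite subr_ge0 ler_pdivrMr ?mul1r.
  apply: cone_eq (coneD (coneZ t0 Pv) (coneZ t1 (mask v l0 Pv))) _ _ => [|l].
    by ring.
  by case: eqP => [->|_]; [rewrite mulr0 addr0 divfK ?gt_eqF|ring].
suff H (s : seq L) : cone P 1 (fun l => if l \in s then y l else x l).
  by apply: cone_eq (H (enum L)) _ _ => // l; rewrite mem_enum.
elim: s => [|l0 s IH]; first by apply: cone_eq Px _ _.
have := lower _ l0 (y l0) IH.
case: ifP => _; rewrite ?lexx ?yx ?andbT; last first.
  by move=> /(_ isT) h; apply: cone_eq h _ _ => // l; rewrite inE; case: eqP => [->|].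
have /andP[-> _] := yx l0.
by move=> /(_ isT) h; apply: cone_eq h _ _ => // l; rewrite inE; case: eqP => [->|].
Qed.

End Cone.

(** * Passing to the limit by compactness of the weights *)

Section Compactness.
Local Open Scope classical_set_scope.
Context {R : realType} {L : finType}.
Import numFieldNormedType.Exports.

Lemma continuous_rowsum N (c : 'I_N -> R) :
  continuous (fun W : 'rV[R]_N => \sum_i W ord0 i * c i).
Proof.
apply: (@continuous_big R^o) => [|i _ W]; first exact: add_continuous.
have coord_cvg : (fun V : 'rV[R]_N => V ord0 i) @ W --> W ord0 i.
  exact: coord_continuous.
exact: (cvgM coord_cvg (cvg_cst (c i))).
Qed.

(** Weights of the finitely many generators range over a compact cube, on which a continuous defect
    attains its minimum. The approximants force this minimum to be 0, and a minimiser yields [x]. *)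
Lemma cone_dominating_limit N (q : 'I_N -> L -> R) (P : set (L -> R)) (r : L -> R) :
    (forall i, P (q i)) -> (forall p, P p -> exists i, p = q i) ->
    (forall eps : R, 0 < eps -> exists2 x, cone P 1 x & forall l, r l - eps <= x l) ->
  exists2 x, cone P 1 x & forall l, r l <= x l.
Proof.
move=> qP Pq near_r.
(* [gap W] vanishes exactly when the combination with weights W has mass 1 and
   dominates r. *)
pose gap (W : 'rV[R]_N) : R := `|\sum_i W ord0 i * 1 - 1| +
  \sum_l Num.max 0 (r l - \sum_i W ord0 i * q i l).
pose cube : set 'rV[R]_N := [set W | forall i, `[0, 1]%classic (W ord0 i)]%classic.
have cube0 : (cube !=set0)%classic.
  by exists 0 => i; rewrite /= mxE in_itv /= lexx ler01.
have cube_compact : compact cube.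
  by apply: (@rV_compact R N (fun=> `[0, 1]%classic)) => _; exact: segment_compact.
have excess_cont : continuous (fun W : 'rV[R]_N =>
    \sum_l Num.max 0 (r l - \sum_i W ord0 i * q i l)).
  apply: (@continuous_big R^o) => [|l _ W]; first exact: add_continuous.
  apply: (@continuous_max _ _ (fun=> 0)
    (fun W : 'rV[R]_N => r l - \sum_i W ord0 i * q i l)).
    exact: (@cst_continuous _ _ (0 : R)).
  exact: (cvgB (cvg_cst (r l)) (@continuous_rowsum N (q^~ l) W)).
have gap_cont : continuous gap.
  move=> W; apply: (cvgD _ (excess_cont W)).
  (* The factor 1 in the mass term makes it an instance of [continuous_rowsum]. *)
  have mass_cvg : (fun W : 'rV[R]_N => \sum_i W ord0 i * 1 - 1) @ W -->
      (\sum_i W ord0 i * 1 - 1 : R).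
    exact: (cvgB (@continuous_rowsum N (fun=> 1) W) (cvg_cst (1 : R))).
  exact: (cvg_norm mass_cvg).
have [W Wcube Wmin] := EVT_min_rV cube0 cube_compact (continuous_subspaceT gap_cont).
have term_ge0 l : 0 <= Num.max 0 (r l - \sum_i W ord0 i * q i l).
  by rewrite le_max lexx.
have gap_le eps : 0 < eps -> gap W <= #|L|%:R * eps.
  move=> eps0; have /near_r[x /(cone_family Pq)[w [w0 ws xE]] rx] := eps0.
  have Vcube : \row_i w i \in cube.
    apply/mem_set => i /=; rewrite mxE in_itv /= w0 /= -ws (bigD1 i) //=.
    by rewrite lerDl sumr_ge0.
  apply: le_trans (Wmin _ Vcube) _; rewrite /gap.
  under eq_bigr do rewrite mxE mulr1.
  rewrite ws subrr normr0 add0r -sum1_card natr_sum mulr_suml ler_sum // => l _.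
  rewrite mul1r ge_max; apply/andP; split.
    exact: ltW.
  under eq_bigr do rewrite mxE.
  by rewrite -xE; have := rx l; lra.
have gap0 : gap W <= 0.
  apply/ler_addgt0Pl => e e0; rewrite addr0.
  have K0 : 0 < #|L|%:R + 1 :> R by rewrite ltr_wpDl.
  apply: le_trans (gap_le _ (divr_gt0 e0 K0)) _.
  by rewrite mulrCA ler_piMr ?(ltW e0) // ler_pdivrMr // mul1r lerDl.
(* Both summands of [gap] are nonnegative, so each of them vanishes at [W]. *)
have W1 : \sum_i W ord0 i = 1.
  apply/eqP; rewrite -subr_eq0 -normr_le0; apply: le_trans gap0.
  under eq_bigr do rewrite -[W _ _]mulr1.
  by rewrite lerDl sumr_ge0.
exists (fun l => \sum_i W ord0 i * q i l) => [|l].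
  apply: cone_eq (cone_sum _ qP) W1 _ => // i.
  by have /set_mem/(_ i) := Wcube; rewrite /= in_itv => /andP[].
rewrite -subr_le0; apply: le_trans gap0; rewrite /gap (bigD1 l) //=.
apply: le_trans (_ : Num.max 0 (r l - \sum_i W ord0 i * q i l) <= _).
  by rewrite le_max lexx orbT.
by rewrite addrCA lerDl addr_ge0 // sumr_ge0.
Qed.

End Compactness.

(** * Decomposition of walks into simple cycles *)

Section Walks.
Context {R : realType} {L : finType} (V : finType) (E : V -> V -> Prop).
Variables (f : V -> L -> R) (P : set (L -> R)).

Definition walk n (A : nat -> V) := forall i, (i < n)%N -> E (A i) (A i.+1).

Hypothesis P_cycle : forall k A, (0 < k)%N -> walk k A -> A k = A 0%N ->
  (forall i j, (i < k)%N -> (j < k)%N -> A i = A j -> i = j) ->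
  P (fun l => k%:R^-1 * \sum_(i < k) f (A i) l).

(** Strong induction on the length: a simple cycle of length [k] is cut out and added with weight
    [k], which cancels the factor [k%:R^-1] of its average. Distinctness in the remainder includes
    its last vertex, so a closed walk leaves nothing behind. *)
Lemma walk_decomposition n A : walk n A ->
  exists n' A' v, [/\ (n' <= n)%N, walk n' A',
    A' 0%N = A 0%N /\ A' n' = A n,
    forall i j, (i <= n')%N -> (j <= n')%N -> A' i = A' j -> i = j &
    cone P (n - n')%:R v /\
    forall l, \sum_(i < n) f (A i) l = v l + \sum_(i < n') f (A' i) l].
Proof.
elim/ltn_ind: n A => n IH A wA.
(* The cycle cut out ends at the first repeated vertex, so that its vertices
   before that one are distinct. *)
pose rep j := (j <= n)%N && [exists i : 'I_j, A i == A j].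
have [/existsP[jj rj]|norep] := boolP [exists j : 'I_n.+1, rep j]; last first.
  exists n, A, (fun=> 0); split=> // [i j i_n j_n Aij|]; last first.
    by rewrite subnn; split=> [|l]; [exact: cone0|rewrite add0r].
  wlog ij : i j i_n j_n Aij / (i < j)%N => [H|].
    by have [/H|/H|] := ltngtP i j => // ->.
  case/negP: norep; apply/existsP; exists (Ordinal (j_n : (j < n.+1)%N)).
  by rewrite /rep j_n; apply/existsP; exists (Ordinal ij); apply/eqP.
have exj : exists j, rep j by exists jj.
case: (ex_minnP exj) => j /andP[jn /existsP[i /eqP Aij]] jmin.
have ij := ltn_ord i.
have inj a b : (a < j)%N -> (b < j)%N -> A a = A b -> a = b.
  move=> aj bj Aab; wlog ab : a b aj bj Aab / (a < b)%N => [H|].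
    by have [/H|/H|] := ltngtP a b => // ->.
  suff /jmin : rep b by rewrite leqNgt bj.
  rewrite /rep (leq_trans (ltnW bj)) //; apply/existsP; exists (Ordinal ab).
  exact/eqP.
pose k := (j - i)%N; pose C t := A (i + t)%N.
pose B t := if (t < i)%N then A t else A (t + k)%N.
have k0 : (0 < k)%N by rewrite subn_gt0.
(* Both branches of [B] agree at [t = i] because [A i = A j]; hence the step into the junction is
   still a step of [A]. *)
have B_lt t : (t <= i)%N -> B t = A t.
  rewrite /B; case: ltnP => // it ti; have -> : t = i by apply/anti_leq/andP.
  by rewrite subnKC // ltnW.
have B_ge t : (i <= t)%N -> B t = A (t + k)%N by rewrite /B ltnNge => ->.
have wB : walk (n - k) B.
  move=> t tn; have [ti|it] := ltnP t i.
    by rewrite !B_lt ?(ltnW ti) //; apply: wA; lia.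
  by rewrite !B_ge ?(leq_trans it) // addSn; apply: wA; lia.
have PC : P (fun l => k%:R^-1 * \sum_(t < k) f (C t) l).
  apply: P_cycle => // [t tk||a b ak bk Cab].
  - by rewrite /C addnS; apply: wA; rewrite /k in tk; lia.
  - by rewrite /C subnKC ?addn0 // ltnW.
  - by apply/(@addnI i)/inj => //; rewrite /k in ak bk; lia.
have [|n' [A' [v [n'n wA' [A'0 A'n] injA' [Pv sumB]]]]] := IH (n - k)%N _ B wB.
  by lia.
exists n', A', (fun l => \sum_(t < k) f (C t) l + v l).
have kR : k%:R != 0 :> R by rewrite pnatr_eq0 -lt0n.
split=> //; first by lia.
- split; first by rewrite A'0 B_lt.
  by rewrite A'n B_ge; [congr A|]; rewrite /k; lia.
split=> [|l].
  apply: cone_eq (coneD (coneZ (ler0n _ k) (cone_gen PC)) Pv) _ _ => [|l].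
    by rewrite mulr1 -natrD; congr _%:R; rewrite /k in n'n *; lia.
  by rewrite mulVKf.
rewrite -addrA -sumB.
have nE : n = (i + (k + (n - j)))%N by rewrite /k; lia.
have nkE : (n - k)%N = (i + (n - j))%N by rewrite /k; lia.
rewrite nkE nE !big_split_ord /=.
have -> : (i + (k + (n - j)) - j = n - j)%N by rewrite /k; lia.
rewrite addrCA; congr (_ + (_ + _)).
  by apply: eq_bigr => t _; rewrite B_lt // ltnW.
by apply: eq_bigr => t _; rewrite B_ge ?leq_addr //; congr (f (A _) l); lia.
Qed.

Lemma closed_walk_cone n A : walk n A -> A n = A 0%N ->
  cone P n%:R (fun l => \sum_(i < n) f (A i) l).
Proof.
move=> wA An0.
have [n' [A' [v [_ _ [A'0 A'n] injA' [Pv sumA]]]]] := walk_decomposition wA.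
have n'0 : n' = 0%N by apply: injA' => //; rewrite A'n A'0.
rewrite n'0 subn0 in Pv; apply: cone_eq Pv _ _ => // l.
by rewrite sumA n'0 big_ord0 addr0.
Qed.

(** The simple remainder has length [n'] below [#|V|] and adds at most 1 per vertex. Normalising the
    cycles by [n - n'] instead of [n] only raises their nonnegative sum. *)
Lemma walk_cone_approx n A : (forall x l, 0 <= f x l <= 1) -> (#|V| < n)%N ->
    (forall p, P p -> forall l, 0 <= p l) -> walk n A ->
  exists2 x, cone P 1 x
    & forall l, n%:R^-1 * (\sum_(i < n) f (A i) l) - n%:R^-1 * #|V|%:R <= x l.
Proof.
move=> f01 Vn P0 wA.
have [n' [A' [v [n'n _ _ injA' [Pv sumA]]]]] := walk_decomposition wA.
have n'V : (n' < #|V|)%N.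
  rewrite -(card_ord n'.+1); apply: (@leq_card _ _ (fun i : 'I_n'.+1 => A' i)).
  by move=> i j /injA' H; apply/val_inj/H; rewrite -ltnS ltn_ord.
have m0 : 0 < (n - n')%:R :> R by rewrite ltr0n; lia.
have n0 : 0 < n%:R :> R by rewrite ltr0n; lia.
exists (fun l => (n - n')%:R^-1 * v l) => [|l].
  have mV0 : 0 <= (n - n')%:R^-1 :> R by rewrite invr_ge0 ltW.
  apply: cone_eq (coneZ mV0 Pv) _ _ => //.
  by rewrite mulVf // gt_eqF.
apply: le_trans (_ : n%:R^-1 * v l <= _).
  rewrite -mulrBr ler_wpM2l ?invr_ge0 ?(ltW n0) // sumA lerBlDl [leRHS]addrC lerD2l.
  apply: le_trans (_ : n'%:R <= _); last by rewrite ler_nat ltnW.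
  rewrite -[in leRHS](card_ord n') -sum1_card natr_sum ler_sum // => i _.
  by have /andP[] := f01 (A' i) l.
rewrite ler_wpM2r ?(cone_ge0 P0 Pv) // lef_pV2 // ler_nat; lia.
Qed.

End Walks.

(** * Schedules, their block walks and cycle rates *)

Section SchedulingGraph.
Context {R : realType} {L : finType}.
Variables (I : L -> {set {set L}}) (D : L -> L -> int).
Implicit Types (S : schedule L) (l : L) (t : int).

Lemma collision_mono S S' l t : (forall l t, S' l t -> S l t) ->
  collision I D S' l t -> collision I D S l t.
Proof.
move=> SS' /exists_inP[phi phiI /forall_inP H]; apply/exists_inP; exists phi => //.
by apply/forall_inP => l' /H /SS'.
Qed.

Lemma collision_free_sub S S' : (forall l t, S' l t -> S l t) ->
  collision_free I D S -> collision_free I D S'.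
Proof. by move=> SS' cS l t /SS'/cS; apply: contra; exact: collision_mono. Qed.

Definition successes S : schedule L := fun l t => S l t && ~~ collision I D S l t.

(** Removing transmissions cannot create a collision, so every success remains one. *)
Lemma collision_free_successes S : collision_free I D (successes S).
Proof.
move=> l t /andP[_]; apply: contra; apply: collision_mono => l' t'.
by case/andP.
Qed.

Lemma collision_free_shift S s : collision_free I D S ->
  collision_free I D (fun l t => S l (s + t)).
Proof.
move=> cS l t /cS; apply: contra => /exists_inP[phi phiI /forall_inP H].
by apply/exists_inP; exists phi => //; apply/forall_inP => l' /H; rewrite addrA.
Qed.

Variable T : nat.
Local Notation edge := (@sg_edge L I D T).
Local Notation rates := (@cycle_rates L I D R T).

(** Shifting time by [i * T] turns blocks [i] and [i + 1] into the blocks 0 and 1 that an edge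
    refers to. *)
Lemma block_walk S n : collision_free I D S ->
  walk edge n (fun i => block S T i%:Z).
Proof.
move=> cS i _; exists (fun l t => S l (i%:Z * T%:Z + t)).
split; first exact: collision_free_shift.
split; apply/ffunP => p; rewrite !ffunE /= ?mul0r ?add0r //.
by rewrite addrA mul1r intS mulrDl mul1r [_ + i%:Z * _]addrC.
Qed.

Definition mask l0 (A : bmat L T) : bmat L T := [ffun p => (p.1 != l0) && A p].

Lemma sg_edge_mask l0 A B : edge A B -> edge (mask l0 A) (mask l0 B).
Proof.
move=> [S [cS [-> ->]]]; exists (fun l t => (l != l0) && S l t).
split; first by apply: collision_free_sub cS => l t /andP[].
by split; apply/ffunP => p; rewrite !ffunE.
Qed.

Definition block_rate (A : bmat L T) l : R := T%:R^-1 * \sum_(j < T) (A (l, j))%:R.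

Lemma cycle_rateE k A :
  @cycle_rate L R T k A = fun l => k%:R^-1 * \sum_(i < k) block_rate (A i) l.
Proof.
by apply/funext => l; rewrite /cycle_rate natrM invfM -mulrA mulr_sumr.
Qed.

Lemma block_rate_bounds A l : (0 < T)%N -> 0 <= block_rate A l <= 1.
Proof.
move=> T0; rewrite /block_rate mulr_ge0 ?invr_ge0 ?sumr_ge0 //=.
rewrite mulrC ler_pdivrMr ?ltr0n // mul1r -[in leRHS](card_ord T) -sum1_card.
by rewrite natr_sum ler_sum // => j _; rewrite lern1 leq_b1.
Qed.

Lemma cycle_rates_walk k A : (0 < k)%N -> walk edge k A -> A k = A 0%N ->
    (forall i j, (i < k)%N -> (j < k)%N -> A i = A j -> i = j) ->
  rates (fun l => k%:R^-1 * \sum_(i < k) block_rate (A i) l).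
Proof. by move=> *; exists k, A; rewrite cycle_rateE. Qed.

Lemma cycle_rates_ge0 p l : rates p -> 0 <= p l.
Proof.
move=> [k [A [_ ->]]]; rewrite mulr_ge0 ?invr_ge0 ?sumr_ge0 // => i _.
by rewrite sumr_ge0.
Qed.

(** Masking may identify distinct vertices, so a masked cycle is only a closed walk and has to be
    decomposed again. *)
Lemma cycle_rates_mask p l0 : rates p ->
  cone rates 1 (fun l => if l == l0 then 0 else p l).
Proof.
move=> [k [A [[k0 [wA [Ak0 _]]] ->]]].
have kR : k%:R != 0 :> R by rewrite pnatr_eq0 -lt0n.
have kV0 : 0 <= k%:R^-1 :> R by rewrite invr_ge0.
have wM : walk edge k (fun i => mask l0 (A i)) by move=> i /wA; exact: sg_edge_mask.
have M0 : mask l0 (A k) = mask l0 (A 0%N) by rewrite Ak0.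
apply: cone_eq (coneZ kV0 (closed_walk_cone cycle_rates_walk wM M0)) _ _ => [|l].
  by rewrite mulVf.
rewrite cycle_rateE; case: eqP => [->|/eqP ll0].
  rewrite big1 ?mulr0 // => i _; rewrite /block_rate big1 ?mulr0 // => j _.
  by rewrite ffunE /= eqxx.
congr (_ * _); apply: eq_bigr => i _; congr (_ * _); apply: eq_bigr => j _.
by rewrite ffunE /= ll0.
Qed.

(** A cycle has at most as many steps as there are vertices, and its rate depends only on its length
    and a table of its vertices, which is finite data. *)
Lemma finite_cycle_rates : exists N (q : 'I_N -> L -> R),
  (forall i, rates (q i)) /\
  forall p, rates p -> exists i, p = q i.
Proof.
pose V := bmat L T.
pose walk_rate (a : 'I_#|V|.+1 * {ffun 'I_#|V|.+1 -> V}) : L -> R :=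
  cycle_rate R a.1 (fun i => a.2 (inord i)).
have cycle_walk_rate p : rates p -> exists a, p = walk_rate a.
  move=> [k [A [[_ [_ [_ injA]]] ->]]].
  have kV : (k <= #|V|)%N.
    rewrite -(card_ord k); apply: (@leq_card _ _ (fun i : 'I_k => A i)).
    by move=> i j /injA H; apply/val_inj/H.
  exists (Ordinal (kV : (k < #|V|.+1)%N), [ffun i => A (val i)]).
  apply/funext => l; rewrite /walk_rate /cycle_rate /=; congr (_ * _).
  apply: eq_bigr => i _; apply: eq_bigr => j _; rewrite ffunE inordK //.
  by rewrite (leq_trans (ltn_ord i)) // ltnW.
(* Arbitrary tables need not describe cycles; only those whose value is a cycle rate are
   enumerated. *)
pose good := [pred a | `[< rates (walk_rate a) >]].
exists #|good|, (fun i => walk_rate (enum_val i)); split=> [i|p Pp].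
  by have := enum_valP i => /asboolP.
have [a pE] := cycle_walk_rate p Pp.
have ga : a \in good by apply/asboolP; rewrite -pE.
by exists (enum_rank_in ga a); rewrite enum_rankK_in.
Qed.

Lemma avg_success_blocks S n l :
  avg_success I D R S l (n * T) =
  n%:R^-1 * \sum_(i < n) block_rate (block (successes S) T i%:Z) l.
Proof.
rewrite /avg_success natrM invfM -mulrA; congr (_ * _).
rewrite -mulr_sumr; congr (_ * _).
elim: n => [|n IH]; first by rewrite !big_ord0.
rewrite mulSnr big_split_ord big_ord_recr /= IH; congr (_ + _).
by apply: eq_bigr => j _; rewrite ffunE /= PoszD PoszM.
Qed.

(** The error splits into three thirds of [eps]: the choice of the schedule, the convergence of its
    time averages, and the part of the walk outside the cycles. *)
Lemma achievable_approx r : (0 < T)%N -> achievable I D r ->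
  forall eps : R, 0 < eps ->
    exists2 x, cone rates 1 x & forall l, r l - eps <= x l.
Proof.
move=> T0 [_ Ar] eps eps0.
have e0 : 0 < eps / 3 by rewrite divr_gt0.
have [S [rS [rS_lim rSr]]] := Ar _ e0.
(* One threshold serves all links, since there are finitely many. *)
have : (\forall n \near \oo,
    forall l, `|rS l - avg_success I D R S l n| < eps / 3)%classic.
  by apply: filter_forall => l; have /cvgrPdist_lt := rS_lim l; exact.
move=> [N _ avg_near].
pose v := #|bmat L T|.
(* The term [N] puts [n * T] past the convergence threshold, the last factor exceeds [3 / eps] and
   so gives [v / n <= eps / 3], and [v.+1] in place of [v] makes [v < n] strict. *)
pose n := (N + v.+1 * (Num.truncn (3 / eps)).+1)%N.
have eps3 : 3 / eps < (Num.truncn (3 / eps)).+1%:R by exact: truncnS_gt.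
have vn : (v < n)%N by rewrite /n; nia.
have n0 : 0 < n%:R :> R by rewrite ltr0n (leq_trans _ vn).
have vn_small : n%:R^-1 * v%:R <= eps / 3.
  rewrite mulrC ler_pdivrMr // mulrC -ler_pdivrMr // invf_div.
  apply: le_trans (_ : v%:R * (Num.truncn (3 / eps)).+1%:R <= _).
    by rewrite ler_wpM2l // ltW.
  by rewrite -natrM ler_nat /n; nia.
have [x Px xge] := walk_cone_approx cycle_rates_walk
  (fun A l => block_rate_bounds A l T0) vn (fun p Pp l => cycle_rates_ge0 l Pp)
  (block_walk (n:=n) (@collision_free_successes S)).
exists x => // l; have := xge l; rewrite -avg_success_blocks -/v => xl.
have NnT : (N <= n * T)%N by rewrite /n; nia.
have := avg_near _ NnT l; rewrite ltr_norml => /andP[_].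
have := rSr l; lra.
Qed.

End SchedulingGraph.

Theorem theorem6 (R : realType) (L : finType) (I : L -> {set {set L}})
    (D : L -> L -> int)
    (HL : (0 < #|L|)%N)
    (HI : forall l phi, phi \in I l -> phi != finset.set0)
    (T : nat) (HT : (1 <= T)%N) :
  forall r : L -> R, achievable I D r -> conv_hull (@cycle_rates L I D R T) r.
Proof.
move=> r Ar; apply/conv_hullE.
have [N [q [qP Pq]]] := @finite_cycle_rates R L I D T.
have [x Px rx] := cone_dominating_limit qP Pq (achievable_approx HT Ar).
apply: cone_down Px _ => [p Pp l|p l0|l].
- exact: cycle_rates_ge0 Pp.
- exact: cycle_rates_mask.
by rewrite rx andbT; case: Ar.
Qed.
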